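(* Let $D_1\subset\mathbb{R}^2$ be an open disc centered at the origin, let $\boldsymbol{\gamma}_1,\dots,\boldsymbol{\gamma}_m$ be distinct unit vectors in $\mathbb{R}^2$ and $c_1,\dots,c_m$ nonzero reals. If $\boldsymbol{\gamma}(\boldsymbol{\psi})\neq 0$ for at least one $\boldsymbol{\psi}\in\mathbb{S}^1\setminus\mathcal{Z}_1$, then the vector-valued star transform $\mathcal{S}$ is invertible, i.e. every vector field $\mathbf{f}$ on $\mathbb{R}^2$ with components in $C^2_c(D_1)$ is uniquely (and explicitly) determined by $\mathcal{S}\mathbf{f}$.
   Context: For $\mathbf{x}=(x_1,x_2)$ set $\mathbf{x}^\perp=(-x_2,x_1)$. For a unit vector $\boldsymbol{\gamma}$, $\mathcal{X}_{\boldsymbol{\gamma}}h(\mathbf{x})=\int_0^\infty h(\mathbf{x}+t\boldsymbol{\gamma})\,dt$. The vector-valued star transform is $\mathcal{S}\mathbf{f}=\sum_{i=1}^m c_i\,\mathcal{X}_{\boldsymbol{\gamma}_i}\begin{bmatrix}\mathbf{f}\cdot\boldsymbol{\gamma}_i\\ \mathbf{f}\cdot\boldsymbol{\gamma}_i^\perp\end{bmatrix}$. $\mathcal{Z}_1=\bigcup_{i}\{\boldsymbol{\psi}\in\mathbb{S}^1:\boldsymbol{\psi}\cdot\boldsymbol{\gamma}_i=0\}$, and for $\boldsymbol{\psi}\in\mathbb{S}^1\setminus\mathcal{Z}_1$, $\boldsymbol{\gamma}(\boldsymbol{\psi})=-\sum_{i=1}^m\frac{c_i\boldsymbol{\gamma}_i}{\boldsymbol{\psi}\cdot\boldsymbol{\gamma}_i}$.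 *)

(* Defs.v *)
From Stdlib Require Import Reals.
From Coquelicot Require Import Coquelicot.
Open Scope R_scope.

Definition pt := (R * R)%type.

Definition dot (x y : pt) : R := fst x * fst y + snd x * snd y.
Definition perp (x : pt) : pt := (- snd x, fst x).
Definition vnorm (x : pt) : R := sqrt (dot x x).
Definition vadd (x y : pt) : pt := (fst x + fst y, snd x + snd y).
Definition vscal (a : R) (x : pt) : pt := (a * fst x, a * snd x).
Definition is_unit (x : pt) : Prop := dot x x = 1.

Fixpoint vsum (m : nat) (F : nat -> pt) : pt :=
  match m with O => (0, 0) | S k => vadd (vsum k F) (F k) end.

Definition d1 (f : pt -> R) (p : pt) : R := Derive (fun t => f (t, snd p)) (fst p).
Definition d2 (f : pt -> R) (p : pt) : R := Derive (fun t => f (fst p, t)) (snd p).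

Definition C1 (f : pt -> R) : Prop :=
  (forall p, ex_derive (fun t => f (t, snd p)) (fst p)) /\
  (forall p, ex_derive (fun t => f (fst p, t)) (snd p)) /\
  (forall p, continuous f p) /\
  (forall p, continuous (d1 f) p) /\
  (forall p, continuous (d2 f) p).

Definition C2 (f : pt -> R) : Prop := C1 f /\ C1 (d1 f) /\ C1 (d2 f).

(* C^2_c(D) with D the open disc of radius r centred at the origin:
   C^2 with (closed) support a compact subset of D, i.e. contained in a
   closed disc of radius r' < r. *)
Definition C2c_disc (r : R) (f : pt -> R) : Prop :=
  C2 f /\ exists r', r' < r /\ forall x, r' <= vnorm x -> f x = 0.

Definition Xray (g : pt) (h : pt -> R) (x : pt) : R :=
  RInt_gen (fun t => h (vadd x (vscal t g))) (at_point 0) (Rbar_locally p_infty).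

Definition vfield := ((pt -> R) * (pt -> R))%type.

Definition fdot (f : vfield) (v : pt) : pt -> R :=
  fun x => fst f x * fst v + snd f x * snd v.

Definition star (m : nat) (gam : nat -> pt) (c : nat -> R) (f : vfield) (x : pt) : pt :=
  vsum m (fun i => vscal (c i)
    (Xray (gam i) (fdot f (gam i)) x, Xray (gam i) (fdot f (perp (gam i))) x)).

Definition not_in_Z1 (m : nat) (gam : nat -> pt) (psi : pt) : Prop :=
  is_unit psi /\ forall i, (i < m)%nat -> dot psi (gam i) <> 0.

Definition gamma_psi (m : nat) (gam : nat -> pt) (c : nat -> R) (psi : pt) : pt :=
  vscal (-1) (vsum m (fun i => vscal (c i / dot psi (gam i)) (gam i))).

(* Main.v *)
Require Import Defs.
From Stdlib Require Import Reals Lra Lia FunctionalExtensionality.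
From Coquelicot Require Import Coquelicot.
Open Scope R_scope.

(* Let h = f - g: its components are continuous with compact support, and S h = 0.
   Fix a slope lam such that nu = (-lam, 1) is off Z_1 and gamma(nu) <> 0, and let
   A_F(s) be the integral of F over the line y = s + lam x. By Fubini and the
   substitution s = b + t (nu . gamma), the integral over x of the beam transform
   X_gamma F at the points (x, b + lam x) is (int_b^oo A_F - E) / (nu . gamma), with E
   independent of b. Weighting by c_i and summing, the two components of S h = 0 give
   p J1 + q J2 = 0 and -q J1 + p J2 = 0 for the tails J_k(b) = int_b^oo A_{h_k},
   where (p, q) = -gamma(nu) <> 0; hence every line integral of h_1 and h_2 with
   slope lam vanishes. Since the condition on nu is open, this holds for a whole
   interval of slopes. After a shear, the moments of h_k appear as the coefficients
   of a polynomial in the slope that vanishes on an interval, so all moments of h_k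
   vanish, and a continuous compactly supported function with vanishing moments is
   zero (integrate it against high powers of a quadratic bump). *)

Definition continuous_everywhere {T : UniformSpace} (f : T -> R) : Prop :=
  forall x, continuous f x.

Lemma continuous_pow_comp {T : UniformSpace} (f : T -> R) (n : nat) (x : T) :
  continuous f x -> continuous (fun t => f t ^ n) x.
Proof.
  intros Hf; induction n as [|n IH]; simpl.
  - apply continuous_const.
  - apply (continuous_mult f (fun t => f t ^ n)); assumption.
Qed.

Lemma continuous_pair {T U V : UniformSpace} (f : T -> U) (g : T -> V) (x : T) :
  continuous f x -> continuous g x -> continuous (fun t => (f t, g t)) x.
Proof.
  intros Hf Hg P [eps HP].
  apply (filterlim_pair f g Hf Hg).
  exists (ball (f x) eps) (ball (g x) eps); try (exists eps; auto).
  intros u v Hu Hv; apply (HP (u, v)); split; assumption.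
Qed.

Lemma continuous_fst_everywhere {U V : UniformSpace} (z : U * V) : continuous fst z.
Proof. destruct z; apply continuous_fst. Qed.

Lemma continuous_snd_everywhere {U V : UniformSpace} (z : U * V) : continuous snd z.
Proof. destruct z; apply continuous_snd. Qed.

Lemma continuous_sum_f_R0 (F : nat -> R -> R) n x :
  (forall i, continuous (F i) x) -> continuous (fun y => sum_f_R0 (fun i => F i y) n) x.
Proof.
  intros HF; induction n as [|n IH]; simpl; [apply HF|].
  apply (continuous_plus (fun y => sum_f_R0 (fun i => F i y) n) (F (S n))); auto.
Qed.

Lemma continuous_nonzero_locally (f : R -> R) x :
  continuous f x -> f x <> 0 -> locally x (fun t => f t <> 0).
Proof.
  intros Hf Hx.
  assert (Hpos : 0 < Rabs (f x)) by (apply Rabs_pos_lt; auto).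
  destruct (proj1 (filterlim_locally f (f x)) Hf (mkposreal _ Hpos)) as [d Hd].
  exists d; intros t Ht Ht0; specialize (Hd t Ht).
  change (Rabs (f t - f x) < Rabs (f x)) in Hd.
  rewrite Ht0, Rminus_0_l, Rabs_Ropp in Hd; lra.
Qed.

Lemma continuous_half_locally (g : R -> R) t0 : continuous g t0 -> 0 < g t0 ->
  exists eta, 0 < eta /\ forall t, Rabs (t - t0) < eta -> g t0 / 2 < g t.
Proof.
  intros Hg Hpos.
  assert (Hk : 0 < g t0 / 2) by lra.
  destruct (proj1 (filterlim_locally g (g t0)) Hg (mkposreal _ Hk)) as [eta Heta].
  exists eta; split; [apply cond_pos|intros t Ht].
  specialize (Heta t Ht); change (Rabs (g t - g t0) < g t0 / 2) in Heta.
  apply Rabs_lt_between' in Heta; lra.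
Qed.

Lemma continuous_vanishing_right (f : R -> R) x d : 0 < d -> continuous f x ->
  (forall t, x < t < x + d -> f t = 0) -> f x = 0.
Proof.
  intros Hd Hf Hzero; destruct (Req_dec (f x) 0) as [|Hx]; auto.
  destruct (continuous_nonzero_locally f x Hf Hx) as [eps He].
  pose proof (cond_pos eps); pose proof (Rmin_l eps d); pose proof (Rmin_r eps d).
  assert (Hm : 0 < Rmin eps d) by (apply Rmin_pos; lra).
  exfalso; apply (He (x + Rmin eps d / 2)).
  - change (Rabs (x + Rmin eps d / 2 - x) < eps); rewrite Rabs_pos_eq; lra.
  - apply Hzero; lra.
Qed.

Lemma ex_RInt_continuous_everywhere (f : R -> R) (a b : R) :
  continuous_everywhere f -> ex_RInt f a b.
Proof. intros Hf; apply (ex_RInt_continuous (V := R_CompleteNormedModule)); auto. Qed.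

Ltac solve_continuous := solve [
  repeat match goal with
  | |- forall _, _ => intro
  | |- continuous_everywhere _ => intro; cbv beta; cbn [fst snd]
  | |- continuous (fun _ => ?c) _ => apply continuous_const
  | |- continuous (fun x => x) _ => apply continuous_id
  | |- continuous fst _ => apply continuous_fst_everywhere
  | |- continuous snd _ => apply continuous_snd_everywhere
  | |- continuous (fun x => fst x) _ => apply continuous_fst_everywhere
  | |- continuous (fun x => snd x) _ => apply continuous_snd_everywhere
  | |- continuous (fun x => @?f x + @?g x) _ => apply (continuous_plus f g)
  | |- continuous (fun x => @?f x - @?g x) _ => apply (continuous_minus f g)
  | |- continuous (fun x => @?f x * @?g x) _ => apply (continuous_mult f g)
  | |- continuous (fun x => - @?f x) _ => apply (continuous_opp f)
  | |- continuous (fun x => @?f x / ?c) _ => apply (continuous_mult f (fun _ => / c))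
  | |- continuous (fun x => @?f x ^ _) _ => apply (continuous_pow_comp f)
  | |- continuous (fun x => Rabs (@?f x)) _ => apply (continuous_Rabs_comp f)
  | |- continuous (fun x => (@?f x, @?g x)) _ => apply (continuous_pair f g)
  | H : continuous_everywhere ?F |- continuous (fun x => ?F (@?f x)) _ =>
      apply (continuous_comp f F); [|apply H]
  | H : continuous_everywhere (fun z => ?F (fst z) (snd z))
    |- continuous (fun x => ?F (@?f x) (@?g x)) _ =>
      apply (continuous_comp_2 f g F); [| |apply H]
  | H : continuous_everywhere ?F |- continuous ?F _ => apply H
  | |- ex_RInt _ _ _ => apply ex_RInt_continuous_everywhere
  end ].

(* [RInt] lands in the carrier of [R_CompleteNormedModule]; [ring] and [lra]
   need the equation restated at type [R]. *)
Ltac real_eq := match goal with |- ?a = ?b => change (@eq R a b) end.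

Section ContinuousIntegrals.
Variables (f g : R -> R).
Hypotheses (Hf : continuous_everywhere f) (Hg : continuous_everywhere g).

Lemma RInt_plus_continuous a b : RInt (fun x => f x + g x) a b = RInt f a b + RInt g a b.
Proof. exact (RInt_plus f g a b ltac:(solve_continuous) ltac:(solve_continuous)). Qed.

Lemma RInt_minus_continuous a b : RInt (fun x => f x - g x) a b = RInt f a b - RInt g a b.
Proof. exact (RInt_minus f g a b ltac:(solve_continuous) ltac:(solve_continuous)). Qed.

Lemma RInt_scal_continuous k a b : RInt (fun x => k * f x) a b = k * RInt f a b.
Proof. exact (RInt_scal f a b k ltac:(solve_continuous)). Qed.

Lemma RInt_Chasles_continuous a b c : RInt f a b + RInt f b c = RInt f a c.
Proof. exact (RInt_Chasles f a b c ltac:(solve_continuous) ltac:(solve_continuous)). Qed.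

Lemma RInt_ge_const a b k : a <= b -> (forall x, a < x < b -> k <= f x) ->
  (b - a) * k <= RInt f a b.
Proof.
  intros Hab Hk.
  replace ((b - a) * k) with (RInt (fun _ => k) a b)
    by (rewrite RInt_const; unfold scal; simpl; unfold mult; simpl; ring).
  apply RInt_le; auto; solve_continuous.
Qed.

End ContinuousIntegrals.

Lemma RInt_sum_f_R0 (F : nat -> R -> R) n a b : (forall i, continuous_everywhere (F i)) ->
  RInt (fun y => sum_f_R0 (fun i => F i y) n) a b = sum_f_R0 (fun i => RInt (F i) a b) n.
Proof.
  intros HF; induction n as [|n IH]; simpl; [reflexivity|].
  rewrite RInt_plus_continuous, IH; auto.
  intros x; apply continuous_sum_f_R0; intros i; apply HF.
Qed.

Lemma RInt_tails_zero (f : R -> R) b : continuous_everywhere f ->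
  (forall a, RInt f a b = 0) -> forall x, f x = 0.
Proof.
  intros Hf Htail x.
  pose proof (Derive_RInt' f x b ltac:(apply filter_forall; intros; solve_continuous) (Hf x)) as D.
  rewrite (Derive_ext _ (fun _ => 0) x Htail), Derive_const in D; lra.
Qed.

Lemma RInt_zero_on (f : R -> R) a b :
  (forall x, Rmin a b < x < Rmax a b -> f x = 0) -> RInt f a b = 0.
Proof.
  intros H; rewrite (RInt_ext f (fun _ => 0)) by auto; rewrite RInt_const.
  unfold scal; simpl; unfold mult; simpl; ring.
Qed.

Lemma RInt_outside_support (f : R -> R) (R0 a b : R) : continuous_everywhere f ->
  (forall y, R0 <= Rabs y -> f y = 0) -> a <= - R0 -> R0 <= b ->
  RInt f a b = RInt f (- R0) R0.
Proof.
  intros Hf Hs Ha Hb.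
  rewrite <- (RInt_Chasles_continuous f Hf a (- R0) b),
          <- (RInt_Chasles_continuous f Hf (- R0) R0 b).
  rewrite (RInt_zero_on f a (- R0)), (RInt_zero_on f R0 b); [real_eq; ring| |];
    intros x Hx; apply Hs; unfold Rmin, Rmax in Hx;
    repeat destruct Rle_dec in Hx; unfold Rabs; destruct Rcase_abs; lra.
Qed.

Lemma derive_zero_constant (h : R -> R) :
  (forall u, is_derive h u 0) -> forall a b, h a = h b.
Proof.
  intros Hh a b.
  assert (HD : forall u, Derive h u = 0) by (intros u; apply is_derive_unique, Hh).
  pose proof (RInt_Derive h a b (fun u _ => ex_intro _ 0 (Hh u))) as E.
  rewrite RInt_zero_on in E by (intros; apply HD).
  - symmetry in E; apply Rminus_diag_uniq in E; auto.
  - intros u _; apply continuous_ext with (f := fun _ => 0); [intros; auto|apply continuous_const].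
Qed.

Section ParametricIntegrals.
Variable F : R -> R -> R.
Hypothesis HF : continuous_everywhere (fun z : R * R => F (fst z) (snd z)).

Let continuous_RInt_param_le a b : a <= b ->
  continuous_everywhere (fun x => RInt (fun t => F x t) a b).
Proof.
  intros Hab x0; apply filterlim_locally; intros eps.
  pose proof (uniform_continuity_2d F (x0 - 1) (x0 + 1) a b
    (fun x y _ _ => proj2 (continuity_2d_pt_filterlim F x y) (HF (x, y)))) as Hunif.
  assert (Heps : 0 < eps / (b - a + 1)) by (apply Rdiv_lt_0_compat; [apply cond_pos|lra]).
  destruct (Hunif (mkposreal _ Heps)) as [d Hd].
  assert (Hdelta : 0 < Rmin d 1) by (apply Rmin_pos; [apply cond_pos|lra]).
  exists (mkposreal _ Hdelta); intros x Hx.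
  change (Rabs (RInt (fun t => F x t) a b - RInt (fun t => F x0 t) a b) < eps).
  change (Rabs (x - x0) < Rmin d 1) in Hx.
  pose proof (Rmin_l d 1); pose proof (Rmin_r d 1).
  rewrite <- RInt_minus_continuous by solve_continuous.
  eapply Rle_lt_trans.
  - apply abs_RInt_le_const with (M := eps / (b - a + 1)); auto; [solve_continuous|].
    intros t Ht; left; apply Hd; try lra.
    + apply Rabs_lt_between' in Hx; lra.
    + rewrite Rminus_diag, Rabs_R0; apply cond_pos.
  - apply Rmult_lt_reg_r with (b - a + 1); [lra|].
    simpl; field_simplify; try lra; pose proof (cond_pos eps); lra.
Qed.

Lemma continuous_RInt_param a b : continuous_everywhere (fun x => RInt (fun t => F x t) a b).
Proof.
  destruct (Rle_lt_dec a b) as [Hab|Hab]; [now apply continuous_RInt_param_le|].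
  intros x; apply continuous_ext with (f := fun x => - RInt (fun t => F x t) b a).
  - intros y; rewrite <- (opp_RInt_swap (fun t => F y t) b a); [reflexivity|solve_continuous].
  - apply (continuous_opp (fun x => RInt (fun t => F x t) b a)).
    apply continuous_RInt_param_le; lra.
Qed.

End ParametricIntegrals.

(* As functions of the upper limit [b], both sides vanish at [a] and have
   derivative [RInt (fun y => F b y) c d]. *)
Lemma RInt_Fubini (F : R -> R -> R) a b c d :
  continuous_everywhere (fun z : R * R => F (fst z) (snd z)) ->
  RInt (fun x => RInt (fun y => F x y) c d) a b
  = RInt (fun y => RInt (fun x => F x y) a b) c d.
Proof.
  intros HF.
  set (K := fun x => RInt (fun y => F x y) c d).
  assert (HK : continuous_everywhere K) by now apply continuous_RInt_param.
  assert (Hprim : forall y u, is_derive (fun z => RInt (fun x => F x y) a z) u (F u y)).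
  { intros y u; apply (is_derive_RInt (fun x => F x y) _ a); [|solve_continuous].
    apply filter_forall; intros z.
    apply (RInt_correct (V := R_CompleteNormedModule)); solve_continuous. }
  assert (Hleft : forall u, is_derive (fun u => RInt K a u) u (K u)).
  { intros u; apply (is_derive_RInt K _ a); [|apply HK].
    apply filter_forall; intros z.
    apply (RInt_correct (V := R_CompleteNormedModule)); solve_continuous. }
  assert (Hright : forall u,
    is_derive (fun u => RInt (fun y => RInt (fun x => F x y) a u) c d) u (K u)).
  { intros u.
    replace (K u) with (RInt (fun y => Derive (fun z => RInt (fun x => F x y) a z) u) c d)
      by (apply RInt_ext; intros y _; apply is_derive_unique, Hprim).
    apply (is_derive_RInt_param (fun u y => RInt (fun x => F x y) a u)).
    - apply filter_forall; intros z y _; eexists; apply Hprim.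
    - intros y _; apply (continuity_2d_pt_ext F).
      + intros x' y'; symmetry; apply is_derive_unique, Hprim.
      + apply continuity_2d_pt_filterlim, HF.
    - apply filter_forall; intros z.
      apply ex_RInt_continuous_everywhere, (continuous_RInt_param (fun y x => F x y)).
      solve_continuous. }
  assert (Hdiff : forall u, is_derive (fun u => RInt K a u
    - RInt (fun y => RInt (fun x => F x y) a u) c d) u 0).
  { intros u; replace 0 with (K u - K u) by ring.
    apply (is_derive_minus (fun u => RInt K a u)
                           (fun u => RInt (fun y => RInt (fun x => F x y) a u) c d)); auto. }
  pose proof (derive_zero_constant _ Hdiff a b) as E; simpl in E.
  rewrite RInt_point, (RInt_zero_on _ c d) in E by (intros; exact (RInt_point _ _)).
  unfold zero, K in *; simpl in E; real_eq; lra.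
Qed.

(** * Functions with vanishing moments *)

Lemma continuous_bounded (g : R -> R) a b : continuous_everywhere g ->
  exists M, forall t, a <= t <= b -> Rabs (g t) <= M.
Proof.
  intros Hg; destruct (Rle_lt_dec a b) as [Hab|Hab].
  - assert (Hc : forall t, a <= t <= b -> continuity_pt (fun t => Rabs (g t)) t)
      by (intros t _; apply continuity_pt_filterlim;
          change (continuous (fun t => Rabs (g t)) t); solve_continuous).
    destruct (continuity_ab_maj (fun t => Rabs (g t)) a b Hab Hc) as [t1 [Ht1 _]].
    exists (Rabs (g t1)); auto.
  - exists 0; intros t Ht; lra.
Qed.

Lemma geometric_domination A B a b : 0 < A -> 0 < b < a ->
  ~ (forall n, A * a ^ n <= B * b ^ n).
Proof.
  intros HA Hba Hdom.
  assert (Hq : Rabs (b / a) < 1)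
    by (rewrite Rabs_pos_eq; [apply (Rdiv_lt_1 b a)|apply Rdiv_le_0_compat]; lra).
  assert (Hbound : 0 < A / (Rabs B + 1))
    by (apply Rdiv_lt_0_compat; [|pose proof (Rabs_pos B)]; lra).
  destruct (pow_lt_1_zero _ Hq _ Hbound) as [N HN]; specialize (HN N (le_n N)).
  rewrite <- RPow_abs, Rabs_pos_eq in HN by (apply Rdiv_le_0_compat; lra).
  assert (Han : 0 < a ^ N) by (apply pow_lt; lra).
  assert (Hbn : b ^ N = (b / a) ^ N * a ^ N)
    by (rewrite <- Rpow_mult_distr; f_equal; field; lra).
  assert (HN' : (b / a) ^ N * (Rabs B + 1) < A).
  { pose proof (Rabs_pos B).
    apply Rmult_lt_reg_r with (/ (Rabs B + 1)); [apply Rinv_0_lt_compat; lra|].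
    rewrite Rmult_assoc, Rinv_r by lra; lra. }
  specialize (Hdom N); rewrite Hbn in Hdom.
  assert (HBz : B * (b / a) ^ N < A).
  { pose proof (Rle_abs B); pose proof (pow_le (b / a) N ltac:(apply Rdiv_le_0_compat; lra)).
    nra. }
  pose proof (Rmult_lt_compat_r _ _ _ Han HBz); rewrite Rmult_assoc in *; lra.
Qed.

Lemma RInt_ge_bump (P : R -> R) a u v b X Y : continuous_everywhere P ->
  a <= u <= v -> v <= b ->
  (forall t, a <= t <= b -> - X <= P t) -> (forall t, u <= t <= v -> Y <= P t) ->
  (v - u) * Y - ((b - a) - (v - u)) * X <= RInt P a b.
Proof.
  intros HP Hauv Hvb Hlow Hbump.
  rewrite <- (RInt_Chasles_continuous P HP a u b), <- (RInt_Chasles_continuous P HP u v b).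
  pose proof (RInt_ge_const P HP a u (- X) ltac:(lra) ltac:(intros; apply Hlow; lra)).
  pose proof (RInt_ge_const P HP u v Y ltac:(lra) ltac:(intros; apply Hbump; lra)).
  pose proof (RInt_ge_const P HP v b (- X) ltac:(lra) ltac:(intros; apply Hlow; lra)).
  revert H H0 H1; generalize (RInt P a u) (RInt P u v) (RInt P v b); simpl; intros; lra.
Qed.

Definition bump (R0 t0 t : R) : R := 1 - (t - t0) ^ 2 / (4 * R0 ^ 2 + 1).

Lemma bump_le R0 t0 t t' : (t - t0) ^ 2 <= (t' - t0) ^ 2 -> bump R0 t0 t' <= bump R0 t0 t.
Proof.
  intros Ht; unfold bump, Rdiv.
  pose proof (Rinv_0_lt_compat (4 * R0 ^ 2 + 1) ltac:(nra)); nra.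
Qed.

Lemma bump_lt R0 t0 t t' : (t - t0) ^ 2 < (t' - t0) ^ 2 -> bump R0 t0 t' < bump R0 t0 t.
Proof.
  intros Ht; unfold bump, Rdiv.
  pose proof (Rinv_0_lt_compat (4 * R0 ^ 2 + 1) ltac:(nra)); nra.
Qed.

Lemma bump_pos R0 t0 t : (t - t0) ^ 2 <= 4 * R0 ^ 2 -> 0 < bump R0 t0 t.
Proof.
  intros Ht; unfold bump; apply Rlt_0_minus, (Rdiv_lt_1 ((t - t0) ^ 2)); nra.
Qed.

(* On [-R0, R0] the bump lies in [0, 1] and peaks at [t0]; as [n] grows its
   powers concentrate where [g] is positive. *)
Lemma bump_powers_concentrate (g : R -> R) R0 t0 : continuous_everywhere g ->
  Rabs t0 < R0 -> 0 < g t0 ->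
  exists w k M a b, 0 < w /\ 0 < k /\ 0 < b < a /\ - R0 <= t0 - w /\ t0 + w <= R0 /\
    (forall n t, - R0 <= t <= R0 -> - (M * b ^ n) <= bump R0 t0 t ^ n * g t) /\
    (forall n t, t0 - w <= t <= t0 + w -> k * a ^ n <= bump R0 t0 t ^ n * g t).
Proof.
  intros Hg Ht0 Hpos.
  pose proof (Rabs_pos t0); pose proof (Rle_abs t0); pose proof (Rle_abs (- t0));
    rewrite Rabs_Ropp in *.
  destruct (continuous_half_locally g t0 (Hg t0) Hpos) as [eta [Heta Hnear]].
  set (w := Rmin (eta / 2) (R0 - Rabs t0)).
  assert (Hw : 0 < w) by (apply Rmin_pos; lra).
  assert (Hw1 : w <= eta / 2) by apply Rmin_l.
  assert (Hw2 : w <= R0 - Rabs t0) by apply Rmin_r.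
  assert (Hbump0 : forall t, - R0 <= t <= R0 -> 0 <= bump R0 t0 t)
    by (intros t Ht; left; apply bump_pos; nra).
  set (a := bump R0 t0 (t0 + w)); set (b := bump R0 t0 (t0 + 2 * w)).
  assert (Hba : 0 < b < a) by (split; [apply bump_pos|apply bump_lt]; nra).
  destruct (continuous_bounded g (- R0) R0 Hg) as [M HM].
  exists w, (g t0 / 2), M, a, b; repeat split; try lra.
  - intros n t Ht.
    pose proof (pow_le (bump R0 t0 t) n (Hbump0 t Ht)); pose proof (pow_le b n ltac:(lra)).
    pose proof (Rabs_pos (g t)); pose proof (HM t Ht).
    destruct (Rlt_le_dec (Rabs (t - t0)) eta) as [Hn|Hf].
    + pose proof (Hnear t Hn); nra.
    + assert (Hqb : bump R0 t0 t ^ n <= b ^ n).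
      { apply pow_incr; split; [apply Hbump0; auto|apply bump_le].
        rewrite <- (pow2_abs (t - t0)); replace (t0 + 2 * w - t0) with (2 * w) by ring.
        apply pow_incr; lra. }
      assert (Habs : Rabs (bump R0 t0 t ^ n * g t) <= M * b ^ n).
      { rewrite Rabs_mult, (Rabs_pos_eq (bump R0 t0 t ^ n)), Rmult_comm by auto.
        apply Rmult_le_compat; auto using Rabs_pos. }
      apply Rabs_le_between in Habs; lra.
  - intros n t Ht; rewrite (Rmult_comm (g t0 / 2)).
    apply Rmult_le_compat; [apply pow_le; lra|lra| |].
    2:{ left; apply Hnear, (Rle_lt_trans _ w); [apply Rabs_le|]; lra. }
    apply pow_incr; split; [lra|apply bump_le].
    rewrite <- (pow2_abs (t - t0)); replace (t0 + w - t0) with w by ring.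
    apply pow_incr; split; [apply Rabs_pos|apply Rabs_le; lra].
Qed.

Section VanishingMoments.
Variables (g : R -> R) (R0 : R).
Hypotheses (Hg : continuous_everywhere g)
  (Hsupp : forall t, R0 <= Rabs t -> g t = 0)
  (Hmom : forall j, RInt (fun t => t ^ j * g t) (- R0) R0 = 0).

(* (1 - (t - t0)^2 / C)^n is a polynomial, so it inherits the vanishing moments. *)
Lemma vanishing_moments_kernel t0 C : C <> 0 -> forall n j,
  RInt (fun t => t ^ j * (1 - (t - t0) ^ 2 / C) ^ n * g t) (- R0) R0 = 0.
Proof.
  intros HC n; induction n as [|n IH]; intros j.
  - rewrite <- (Hmom j); apply RInt_ext; intros t _; simpl; ring.
  - set (phi := fun j t => t ^ j * (1 - (t - t0) ^ 2 / C) ^ n * g t).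
    rewrite (RInt_ext _ (fun t => phi j t - / C * (phi (S (S j)) t
                                  - (2 * t0) * phi (S j) t + t0 ^ 2 * phi j t)))
      by (intros t _; unfold phi; simpl; field; auto).
    rewrite RInt_minus_continuous, RInt_scal_continuous, RInt_plus_continuous,
      RInt_minus_continuous, !RInt_scal_continuous by (unfold phi; solve_continuous).
    unfold phi; rewrite !IH; real_eq; ring.
Qed.

Lemma vanishing_moments_nonpos t0 : g t0 <= 0.
Proof.
  destruct (Rle_lt_dec (g t0) 0) as [|Hpos]; auto; exfalso.
  assert (Ht0 : Rabs t0 < R0)
    by (destruct (Rlt_le_dec (Rabs t0) R0) as [|H]; auto; rewrite Hsupp in Hpos; lra).
  destruct (bump_powers_concentrate g R0 t0 Hg Ht0 Hpos)
    as [w [k [M [a [b [Hw [Hk [Hba [Hl [Hr [Hlow Hpeak]]]]]]]]]]].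
  apply (geometric_domination (2 * w * k) ((2 * R0 - 2 * w) * M) a b); [nra|auto|]; intros n.
  assert (Hzero : RInt (fun t => bump R0 t0 t ^ n * g t) (- R0) R0 = 0).
  { rewrite <- (vanishing_moments_kernel t0 (4 * R0 ^ 2 + 1) ltac:(nra) n 0).
    apply RInt_ext; intros t _; unfold bump; simpl; ring. }
  pose proof (RInt_ge_bump (fun t => bump R0 t0 t ^ n * g t) (- R0) (t0 - w) (t0 + w) R0
    (M * b ^ n) (k * a ^ n) ltac:(unfold bump; solve_continuous) ltac:(lra) Hr
    (Hlow n) (Hpeak n)) as Hbound.
  replace (2 * w * k * a ^ n) with (2 * w * (k * a ^ n)) by ring.
  replace ((2 * R0 - 2 * w) * M * b ^ n) with ((2 * R0 - 2 * w) * (M * b ^ n)) by ring.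
  rewrite Hzero in Hbound; revert Hbound; generalize (M * b ^ n) (k * a ^ n); intros X Y.
  lra.
Qed.

End VanishingMoments.

Lemma vanishing_moments_zero (g : R -> R) R0 : continuous_everywhere g ->
  (forall t, R0 <= Rabs t -> g t = 0) ->
  (forall j, RInt (fun t => t ^ j * g t) (- R0) R0 = 0) -> forall t, g t = 0.
Proof.
  intros Hg Hsupp Hmom t; apply Rle_antisym; [now apply (vanishing_moments_nonpos g R0)|].
  apply Ropp_le_cancel; rewrite Ropp_0.
  apply (vanishing_moments_nonpos (fun t => - g t) R0); [solve_continuous| |].
  - intros u Hu; rewrite Hsupp; auto; ring.
  - intros j; rewrite (RInt_ext _ (fun u => -1 * (u ^ j * g u))) by (intros; real_eq; ring).
    rewrite RInt_scal_continuous, Hmom by solve_continuous; real_eq; ring.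
Qed.

Lemma polynomial_coefficients_zero n : forall (a : nat -> R) d, 0 < d ->
  (forall e, 0 < e < d -> sum_f_R0 (fun j => a j * e ^ j) n = 0) ->
  forall j, (j <= n)%nat -> a j = 0.
Proof.
  induction n as [|n IH]; intros a d Hd Hzero j Hj.
  - replace j with 0%nat by lia; specialize (Hzero (d / 2) ltac:(lra)); simpl in Hzero; lra.
  - assert (Hsplit : forall e, sum_f_R0 (fun j => a j * e ^ j) (S n)
                             = a 0%nat + e * sum_f_R0 (fun j => a (S j) * e ^ j) n).
    { intros e; rewrite decomp_sum by lia; simpl pred; f_equal; [simpl; ring|].
      rewrite scal_sum; apply sum_eq; intros i _; simpl; ring. }
    assert (Ha0 : a 0%nat = 0).
    { transitivity (sum_f_R0 (fun j => a j * 0 ^ j) (S n)); [rewrite Hsplit; ring|].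
      apply (continuous_vanishing_right (fun e => sum_f_R0 (fun j => a j * e ^ j) (S n)) 0 d Hd);
        [|intros; apply Hzero; lra].
      apply continuous_sum_f_R0; intros i; solve_continuous. }
    destruct j as [|j]; auto.
    apply (IH (fun j => a (S j)) d Hd); [|lia].
    intros e He; specialize (Hzero e He); rewrite Hsplit, Ha0, Rplus_0_l in Hzero.
    destruct (Rmult_integral _ _ Hzero); [lra|auto].
Qed.

(** * Line integrals *)

Definition supported_in_box (R0 : R) (H : pt -> R) : Prop :=
  forall y : pt, R0 <= Rabs (fst y) \/ R0 <= Rabs (snd y) -> H y = 0.

(* The integral of [H] over the line [y = s + lam x]; it is the whole line
   integral as soon as [H] is supported in the box of half-width [R0]. *)
Definition line_integral (R0 : R) (H : pt -> R) (lam s : R) : R :=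
  RInt (fun x => H (x, s + lam * x)) (- R0) R0.

Lemma continuous_line_integral R0 H lam : continuous_everywhere H ->
  continuous_everywhere (line_integral R0 H lam).
Proof.
  intros HH; apply (continuous_RInt_param (fun s x => H (x, s + lam * x))); solve_continuous.
Qed.

Lemma line_integral_outside R0 H lam s : 0 <= R0 -> supported_in_box R0 H ->
  R0 + Rabs lam * R0 <= Rabs s -> line_integral R0 H lam s = 0.
Proof.
  intros HR Hbox Hs; apply RInt_zero_on; intros x Hx.
  rewrite Rmin_left, Rmax_right in Hx by lra.
  apply Hbox; right; simpl.
  assert (Hlx : Rabs (lam * x) <= Rabs lam * R0).
  { rewrite Rabs_mult; apply Rmult_le_compat_l; [apply Rabs_pos|apply Rabs_le; lra]. }
  pose proof (Rabs_triang_inv s (- (lam * x))) as Htri.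
  rewrite Rabs_Ropp in Htri; replace (s - - (lam * x)) with (s + lam * x) in Htri by ring; lra.
Qed.

Lemma binomial_pos n i : 0 < Binomial.C n i.
Proof.
  unfold Binomial.C; apply Rdiv_lt_0_compat; [|apply Rmult_lt_0_compat]; apply INR_fact_lt_0.
Qed.

Section Radon.
Variables (H : pt -> R) (R0 d : R).
Hypotheses (HR : 0 < R0) (Hd : 0 < d) (HH : continuous_everywhere H)
  (Hbox : supported_in_box R0 H)
  (Hlines : forall e, 0 < e < d -> forall s, line_integral R0 H e s = 0).

Let moment l x := RInt (fun y => y ^ l * H (x, y)) (- R0) R0.
Let mixed_moment j l := RInt (fun x => x ^ j * moment l x) (- R0) R0.

Let continuous_moment l : continuous_everywhere (moment l).
Proof. apply (continuous_RInt_param (fun x y => y ^ l * H (x, y))); solve_continuous. Qed.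

Lemma shifted_moment n e x : 0 < e < 1 -> - R0 < x < R0 ->
  RInt (fun s => s ^ n * H (x, s + e * x)) (- (2 * R0)) (2 * R0)
  = sum_f_R0 (fun i => Binomial.C n i * (-1) ^ i * e ^ i * (x ^ i * moment (n - i) x)) n.
Proof.
  intros He Hx.
  set (f := fun y => (y - e * x) ^ n * H (x, y)).
  assert (Hf : continuous_everywhere f) by (unfold f; solve_continuous).
  assert (Hex : Rabs (e * x) < R0).
  { rewrite Rabs_mult, Rabs_pos_eq by lra.
    assert (Rabs x < R0) by (apply Rabs_def1; lra); nra. }
  apply Rabs_def2 in Hex.
  pose proof (RInt_comp_lin f 1 (e * x) (- (2 * R0)) (2 * R0)
    ltac:(solve_continuous)) as Eshift.
  rewrite (RInt_ext _ (fun s => s ^ n * H (x, s + e * x))) in Eshift.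
  2:{ intros s _; unfold f, scal; simpl; unfold mult; simpl.
      replace (1 * s + e * x - e * x) with s by ring.
      replace (1 * s + e * x) with (s + e * x) by ring; real_eq; ring. }
  rewrite Eshift, (RInt_outside_support f R0) by
    (auto; try (intros y Hy; unfold f; rewrite Hbox by (right; auto); ring); lra).
  rewrite (RInt_ext f (fun y => sum_f_R0 (fun i => Binomial.C n i * (-1) ^ i * e ^ i * x ^ i
                                                * (y ^ (n - i) * H (x, y))) n)).
  2:{ intros y _; unfold f; replace (y - e * x) with (- e * x + y) by ring.
      rewrite binomial, Rmult_comm, scal_sum; apply sum_eq; intros i _.
      replace (- e * x) with (-1 * e * x) by ring; rewrite !Rpow_mult_distr; ring. }
  rewrite RInt_sum_f_R0 by solve_continuous.
  apply sum_eq; intros i _; rewrite RInt_scal_continuous by solve_continuous.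
  unfold moment; real_eq; ring.
Qed.

Lemma line_integral_moments n e : 0 < e < 1 ->
  RInt (fun s => s ^ n * line_integral R0 H e s) (- (2 * R0)) (2 * R0)
  = sum_f_R0 (fun i => Binomial.C n i * (-1) ^ i * mixed_moment i (n - i) * e ^ i) n.
Proof.
  intros He; unfold line_integral.
  rewrite (RInt_ext _ (fun s => RInt (fun x => s ^ n * H (x, s + e * x)) (- R0) R0))
    by (intros s _; symmetry; apply RInt_scal_continuous; solve_continuous).
  rewrite (RInt_Fubini (fun s x => s ^ n * H (x, s + e * x))) by solve_continuous.
  rewrite (RInt_ext _ (fun x => sum_f_R0 (fun i => Binomial.C n i * (-1) ^ i * e ^ i
                                                   * (x ^ i * moment (n - i) x)) n)).
  2:{ intros x Hx; rewrite Rmin_left, Rmax_right in Hx by lra; apply shifted_moment; lra. }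
  rewrite RInt_sum_f_R0 by (intros i; pose proof (continuous_moment (n - i)); solve_continuous).
  apply sum_eq; intros i _; pose proof (continuous_moment (n - i)).
  rewrite RInt_scal_continuous by solve_continuous.
  unfold mixed_moment; real_eq; ring.
Qed.

Lemma mixed_moments_zero j l : mixed_moment j l = 0.
Proof.
  assert (Hd1 : 0 < Rmin d 1) by (apply Rmin_pos; lra).
  assert (Hpoly : forall e, 0 < e < Rmin d 1 -> sum_f_R0 (fun i =>
    Binomial.C (j + l) i * (-1) ^ i * mixed_moment i (j + l - i) * e ^ i) (j + l) = 0).
  { intros e He; pose proof (Rmin_l d 1); pose proof (Rmin_r d 1).
    rewrite <- line_integral_moments by lra.
    apply RInt_zero_on; intros s _; rewrite Hlines by lra; ring. }
  pose proof (polynomial_coefficients_zero _ _ _ Hd1 Hpoly j ltac:(lia)) as Hcoef.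
  cbv beta in Hcoef; replace (j + l - j)%nat with l in Hcoef by lia.
  pose proof (binomial_pos (j + l) j); pose proof (pow_nonzero (-1) j ltac:(lra)).
  destruct (Rmult_integral _ _ Hcoef) as [Hz|]; auto.
  destruct (Rmult_integral _ _ Hz); lra || contradiction.
Qed.

Lemma zero_of_line_integrals_small_slopes : forall y, H y = 0.
Proof.
  assert (Hmoment : forall l x, moment l x = 0).
  { intros l; apply (vanishing_moments_zero _ R0 (continuous_moment l)).
    - intros x Hx; apply RInt_zero_on; intros y _; rewrite Hbox by (left; auto); ring.
    - intros j; apply mixed_moments_zero. }
  intros [x y]; apply (vanishing_moments_zero (fun y => H (x, y)) R0); [solve_continuous| |].
  - intros t Ht; apply Hbox; right; auto.
  - intros l; apply Hmoment.
Qed.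

End Radon.

Lemma zero_of_line_integrals_slope_interval (H : pt -> R) R0 lam0 d :
  0 < R0 -> 0 < d -> continuous_everywhere H -> supported_in_box R0 H ->
  (forall lam, lam0 < lam < lam0 + d -> forall s, line_integral R0 H lam s = 0) ->
  forall y, H y = 0.
Proof.
  intros HR Hd HH Hbox Hlines [x y].
  set (R1 := R0 + Rabs lam0 * R0).
  assert (HR1 : R0 <= R1) by (unfold R1; pose proof (Rabs_pos lam0); nra).
  set (G := fun p : pt => H (fst p, snd p + lam0 * fst p)).
  assert (HG : forall p, G p = 0).
  { apply (zero_of_line_integrals_small_slopes G R1 d); try lra; [unfold G; solve_continuous| |].
    - intros [u v] Huv; unfold G; simpl in *.
      destruct (Rle_lt_dec R0 (Rabs u)) as [Hu|Hu]; apply Hbox; [left; auto|right; simpl].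
      destruct Huv as [Huv|Hv]; [lra|].
      assert (Rabs (lam0 * u) <= Rabs lam0 * R0)
        by (rewrite Rabs_mult; apply Rmult_le_compat_l; [apply Rabs_pos|lra]).
      pose proof (Rabs_triang_inv v (- (lam0 * u))) as Htri.
      rewrite Rabs_Ropp in Htri; replace (v - - (lam0 * u)) with (v + lam0 * u) in Htri by ring.
      unfold R1 in Hv; lra.
    - intros e He s; rewrite <- (Hlines (lam0 + e)) with (s := s) by lra.
      unfold line_integral, G; simpl.
      rewrite (RInt_outside_support _ R0) by
        (solve_continuous || (intros; apply Hbox; left; auto) || lra).
      apply RInt_ext; intros u _; f_equal; f_equal; ring. }
  specialize (HG (x, y - lam0 * x)); unfold G in HG; simpl in HG.
  replace (y - lam0 * x + lam0 * x) with y in HG by ring; exact HG.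
Qed.

Fixpoint rsum (m : nat) (F : nat -> R) : R :=
  match m with O => 0 | S k => rsum k F + F k end.

Lemma vsum_fst m F : fst (vsum m F) = rsum m (fun i => fst (F i)).
Proof. induction m as [|m IH]; simpl; [|rewrite IH]; reflexivity. Qed.

Lemma vsum_snd m F : snd (vsum m F) = rsum m (fun i => snd (F i)).
Proof. induction m as [|m IH]; simpl; [|rewrite IH]; reflexivity. Qed.

Lemma rsum_ext m F G : (forall i, (i < m)%nat -> F i = G i) -> rsum m F = rsum m G.
Proof. induction m as [|m IH]; simpl; intros H; auto; rewrite IH, H; auto. Qed.

Lemma rsum_plus m F G : rsum m (fun i => F i + G i) = rsum m F + rsum m G.
Proof. induction m as [|m IH]; simpl; [|rewrite IH]; ring. Qed.

Lemma rsum_minus m F G : rsum m (fun i => F i - G i) = rsum m F - rsum m G.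
Proof. induction m as [|m IH]; simpl; [|rewrite IH]; ring. Qed.

Lemma rsum_scal m F k : rsum m (fun i => k * F i) = k * rsum m F.
Proof. induction m as [|m IH]; simpl; [|rewrite IH]; ring. Qed.

Lemma continuous_rsum (F : nat -> R -> R) m x : (forall i, (i < m)%nat -> continuous (F i) x) ->
  continuous (fun t => rsum m (fun i => F i t)) x.
Proof.
  induction m as [|m IH]; intros HF; simpl; [apply continuous_const|].
  apply (continuous_plus (fun t => rsum m (fun i => F i t)) (F m)); [apply IH; auto|apply HF; lia].
Qed.

Lemma RInt_rsum (F : nat -> R -> R) m a b :
  (forall i, (i < m)%nat -> continuous_everywhere (F i)) ->
  RInt (fun y => rsum m (fun i => F i y)) a b = rsum m (fun i => RInt (F i) a b).
Proof.
  induction m as [|m IH]; intros HF; simpl; [apply RInt_zero_on; auto|].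
  assert (Hsum : continuous_everywhere (fun y => rsum m (fun i => F i y)))
    by (intros x; apply continuous_rsum; intros i Hi; apply HF; lia).
  rewrite RInt_plus_continuous, IH; auto; apply HF; lia.
Qed.

Lemma exists_upper_bound (a : nat -> R) m : exists M, forall i, (i < m)%nat -> a i <= M.
Proof.
  induction m as [|m [M HM]]; [exists 0; intros; lia|].
  exists (Rmax M (a m)); intros i Hi; destruct (Nat.eq_dec i m) as [->|]; [apply Rmax_r|].
  apply Rle_trans with M; [apply HM; lia|apply Rmax_l].
Qed.

Lemma Xray_truncate (g : pt) (F : pt -> R) x T : 0 <= T -> continuous_everywhere F ->
  (forall t, T <= t -> F (vadd x (vscal t g)) = 0) ->
  Xray g F x = RInt (fun t => F (vadd x (vscal t g))) 0 T.
Proof.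
  intros HT HF Hzero; unfold Xray.
  set (phi := fun t => F (vadd x (vscal t g))).
  assert (Hphi : continuous_everywhere phi) by (unfold phi, vadd, vscal; solve_continuous).
  apply (is_RInt_gen_unique (Fa := at_point 0) (Fb := Rbar_locally p_infty)).
  intros P HP; apply (Filter_prod _ _ _ (fun a => a = 0) (fun b => T < b)).
  - reflexivity.
  - exists T; auto.
  - intros a b -> Hb; exists (RInt phi 0 T); split.
    + replace (RInt phi 0 T) with (RInt phi 0 b).
      * apply (RInt_correct (V := R_CompleteNormedModule)); solve_continuous.
      * rewrite <- (RInt_Chasles_continuous phi Hphi 0 T b), (RInt_zero_on phi T b);
          [real_eq; ring|].
        intros y Hy; rewrite Rmin_left in Hy by lra; apply Hzero; lra.
    + apply locally_singleton, HP.
Qed.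

Lemma ray_leaves_box (g : pt) R0 x : is_unit g -> exists T, 0 <= T /\ forall t, T <= t ->
  R0 <= Rabs (fst (vadd x (vscal t g))) \/ R0 <= Rabs (snd (vadd x (vscal t g))).
Proof.
  unfold is_unit, dot; intros Hg.
  set (T := Rabs (fst x) + Rabs (snd x) + 2 * Rabs R0).
  pose proof (Rabs_pos (fst x)); pose proof (Rabs_pos (snd x)).
  pose proof (Rabs_pos R0); pose proof (Rle_abs R0).
  exists T; split; [unfold T; lra|intros t Ht; simpl].
  assert (Hsum : 1 <= Rabs (fst g) + Rabs (snd g)).
  { pose proof (Rabs_pos (fst g)); pose proof (Rabs_pos (snd g)).
    pose proof (Rsqr_abs (fst g)); pose proof (Rsqr_abs (snd g)); unfold Rsqr in *; nra. }
  destruct (Rle_lt_dec R0 (Rabs (fst x + t * fst g))) as [|Hx1]; [left; auto|right].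
  destruct (Rle_lt_dec R0 (Rabs (snd x + t * snd g))) as [|Hx2]; auto; exfalso.
  pose proof (Rabs_triang_inv (t * fst g) (- fst x)) as E1.
  pose proof (Rabs_triang_inv (t * snd g) (- snd x)) as E2.
  rewrite Rabs_Ropp, Rabs_mult, (Rabs_pos_eq t) in E1, E2 by (unfold T in Ht; lra).
  replace (t * fst g - - fst x) with (fst x + t * fst g) in E1 by ring.
  replace (t * snd g - - snd x) with (snd x + t * snd g) in E2 by ring.
  unfold T in Ht; nra.
Qed.

Lemma Xray_sub (g : pt) R0 (H F G : pt -> R) x : is_unit g ->
  continuous_everywhere F -> continuous_everywhere G ->
  supported_in_box R0 F -> supported_in_box R0 G -> (forall y, H y = F y - G y) ->
  Xray g H x = Xray g F x - Xray g G x.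
Proof.
  intros Hg HF HG BF BG HH.
  assert (HHc : continuous_everywhere H)
    by (intros y; apply (continuous_ext (fun y => F y - G y)); auto; solve_continuous).
  destruct (ray_leaves_box g R0 x Hg) as [T [HT Hout]].
  rewrite !(Xray_truncate g _ x T) by (auto; intros t Ht; rewrite ?HH, ?BF, ?BG; auto; ring).
  rewrite <- RInt_minus_continuous by (unfold vadd, vscal; solve_continuous).
  apply RInt_ext; intros; apply HH.
Qed.

Definition vfield_sub (f g : vfield) : vfield :=
  (fun y => fst f y - fst g y, fun y => snd f y - snd g y).

Definition continuous_field_in_box (R0 : R) (f : vfield) : Prop :=
  continuous_everywhere (fst f) /\ continuous_everywhere (snd f) /\
  supported_in_box R0 (fst f) /\ supported_in_box R0 (snd f).

Lemma continuous_fdot R0 f v : continuous_field_in_box R0 f -> continuous_everywhere (fdot f v).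
Proof. intros [Hf1 [Hf2 _]]; unfold fdot; solve_continuous. Qed.

Lemma supported_fdot R0 f v : continuous_field_in_box R0 f -> supported_in_box R0 (fdot f v).
Proof. intros [_ [_ [Hb1 Hb2]]] y Hy; unfold fdot; rewrite Hb1, Hb2 by auto; ring. Qed.

Lemma continuous_field_in_box_sub R0 f g : continuous_field_in_box R0 f ->
  continuous_field_in_box R0 g -> continuous_field_in_box R0 (vfield_sub f g).
Proof.
  intros [Hf1 [Hf2 [Bf1 Bf2]]] [Hg1 [Hg2 [Bg1 Bg2]]]; unfold vfield_sub; simpl.
  repeat split; [solve_continuous|solve_continuous| |];
    intros y Hy; simpl; [rewrite Bf1, Bg1 by auto|rewrite Bf2, Bg2 by auto]; ring.
Qed.

Lemma star_fst m gam c f x :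
  fst (star m gam c f x) = rsum m (fun i => c i * Xray (gam i) (fdot f (gam i)) x).
Proof. unfold star; apply vsum_fst. Qed.

Lemma star_snd m gam c f x :
  snd (star m gam c f x) = rsum m (fun i => c i * Xray (gam i) (fdot f (perp (gam i))) x).
Proof. unfold star; apply vsum_snd. Qed.

Lemma star_sub m gam c R0 f g x : (forall i, (i < m)%nat -> is_unit (gam i)) ->
  continuous_field_in_box R0 f -> continuous_field_in_box R0 g ->
  star m gam c (vfield_sub f g) x = vadd (star m gam c f x) (vscal (-1) (star m gam c g x)).
Proof.
  intros Hunit Hf Hg.
  assert (Hsub : forall V : nat -> pt,
    rsum m (fun i => c i * Xray (gam i) (fdot (vfield_sub f g) (V i)) x)
    = rsum m (fun i => c i * Xray (gam i) (fdot f (V i)) x)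
      - rsum m (fun i => c i * Xray (gam i) (fdot g (V i)) x)).
  { intros V; rewrite <- rsum_minus; apply rsum_ext; intros i Hi.
    rewrite <- Rmult_minus_distr_l; f_equal.
    apply (Xray_sub _ R0); eauto using continuous_fdot, supported_fdot.
    intros y; unfold fdot, vfield_sub; simpl; ring. }
  apply injective_projections; unfold vadd, vscal; cbn [fst snd].
  - rewrite !star_fst, (Hsub gam); ring.
  - rewrite !star_snd, (Hsub (fun i => perp (gam i))); ring.
Qed.

(** * Integrating a beam transform along parallel lines *)

Section BeamAlongLines.
Variables (H : pt -> R) (R0 lam b : R) (g : pt).
Hypotheses (HR : 0 < R0) (HH : continuous_everywhere H) (Hbox : supported_in_box R0 H).

(* Along the ray from [(x, b + lam x)] in direction [g] the intercept
   [y - lam x] of the line through the current point moves at speed [beta]. *)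
Let beta := dot (- lam, 1) g.
Let S := R0 + Rabs lam * R0.
Let K := R0 + Rabs b + Rabs lam * R0.
Let A := line_integral R0 H lam.

Lemma ray_outside_box x t : beta <> 0 -> K / Rabs beta <= t ->
  H (x + t * fst g, b + lam * x + t * snd g) = 0.
Proof.
  intros Hbeta Ht.
  assert (Hb : 0 < Rabs beta) by (apply Rabs_pos_lt; auto).
  pose proof (Rabs_pos b); pose proof (Rabs_pos lam).
  assert (HK : K <= Rabs beta * t).
  { apply (Rmult_le_compat_l (Rabs beta)) in Ht; [|lra].
    unfold Rdiv in Ht; rewrite <- Rmult_assoc, (Rmult_comm (Rabs beta)), Rmult_assoc, Rinv_r,
      Rmult_1_r in Ht; lra. }
  assert (Ht0 : 0 <= t) by (apply Rle_trans with (K / Rabs beta); auto;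
                            apply Rdiv_le_0_compat; unfold K; nra).
  apply Hbox; simpl.
  set (p := x + t * fst g).
  destruct (Rle_lt_dec R0 (Rabs p)) as [|Hp]; [left; auto|right].
  replace (b + lam * x + t * snd g) with (t * beta - (- b - lam * p))
    by (unfold p, beta, dot; simpl; ring).
  assert (Hlp : Rabs (lam * p) <= Rabs lam * R0)
    by (rewrite Rabs_mult; apply Rmult_le_compat_l; lra).
  assert (Htb : Rabs (t * beta) = Rabs beta * t)
    by (rewrite Rabs_mult, (Rabs_pos_eq t) by lra; ring).
  pose proof (Rabs_triang (- b) (- (lam * p))); rewrite !Rabs_Ropp in *.
  pose proof (Rabs_triang_inv (t * beta) (- b - lam * p)).
  unfold Rminus in *; unfold K in HK; lra.
Qed.

Lemma continuous_Xray_along_line : beta <> 0 ->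
  continuous_everywhere (fun x => Xray g H (x, b + lam * x)).
Proof.
  intros Hbeta x; set (T := Rmax 0 (K / Rabs beta)).
  apply (continuous_ext (fun x => RInt (fun t => H (x + t * fst g, b + lam * x + t * snd g)) 0 T)).
  - intros y; symmetry; apply Xray_truncate; [apply Rmax_l|auto|].
    intros t Ht; apply ray_outside_box; auto; apply Rle_trans with T; [apply Rmax_r|auto].
  - apply (continuous_RInt_param (fun x t => H (x + t * fst g, b + lam * x + t * snd g))).
    solve_continuous.
Qed.

Lemma RInt_ray_shift X t : Rabs (fst g) <= 1 -> R0 + Rabs t <= X ->
  RInt (fun x => H (x + t * fst g, b + lam * x + t * snd g)) (- X) X = A (b + t * beta).
Proof.
  intros Hg1 HX.
  set (f := fun y => H (y, b + t * beta + lam * y)).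
  assert (Hf : continuous_everywhere f) by (unfold f; solve_continuous).
  assert (Htg : Rabs (t * fst g) <= Rabs t)
    by (rewrite Rabs_mult; pose proof (Rabs_pos t); pose proof (Rabs_pos (fst g)); nra).
  apply Rabs_le_between in Htg.
  pose proof (RInt_comp_lin f 1 (t * fst g) (- X) X ltac:(solve_continuous)) as Eshift.
  rewrite (RInt_ext _ (fun x => H (x + t * fst g, b + lam * x + t * snd g))) in Eshift.
  2:{ intros x _; unfold f, scal; simpl; unfold mult; simpl; rewrite !Rmult_1_l.
      f_equal; f_equal; unfold beta, dot; simpl; ring. }
  rewrite Eshift, !Rmult_1_l.
  unfold A, line_integral; fold f.
  apply RInt_outside_support; auto; [|lra|lra].
  intros y Hy; apply Hbox; left; auto.
Qed.

Lemma RInt_line_integral_ray T : beta <> 0 ->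
  RInt (fun t => A (b + t * beta)) 0 T = RInt A b (b + beta * T) / beta.
Proof.
  intros Hbeta.
  assert (HA : continuous_everywhere A) by now apply continuous_line_integral.
  pose proof (RInt_comp_lin A beta b 0 T ltac:(solve_continuous)) as E.
  rewrite (RInt_ext _ (fun t => beta * A (b + t * beta))) in E.
  2:{ intros y _; unfold scal; simpl; unfold mult; simpl; do 2 f_equal; ring. }
  rewrite RInt_scal_continuous in E by solve_continuous.
  replace (beta * 0 + b) with b in E by ring; rewrite Rplus_comm in E.
  rewrite <- E; unfold Rdiv; rewrite Rmult_comm, <- Rmult_assoc, Rinv_l, Rmult_1_l; auto.
Qed.

Lemma RInt_line_integral_tail T : beta <> 0 -> K <= Rabs beta * T ->
  RInt A b (b + beta * T)
  = RInt A b S - (if Rlt_dec beta 0 then RInt A (- S) S else 0).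
Proof.
  intros Hbeta HK.
  assert (HA : continuous_everywhere A) by now apply continuous_line_integral.
  assert (HAout : forall s, S <= Rabs s -> A s = 0)
    by (intros; apply line_integral_outside; auto; lra).
  pose proof (Rabs_pos b); pose proof (Rabs_pos lam); pose proof (Rle_abs b);
    pose proof (Rle_abs (- b)); rewrite Rabs_Ropp in *.
  assert (HS : 0 <= S) by (unfold S; nra).
  destruct (Rlt_dec beta 0) as [Hneg|Hpos].
  - rewrite Rabs_left in HK by auto.
    rewrite <- (RInt_Chasles_continuous A HA b S (b + beta * T)),
      <- (RInt_Chasles_continuous A HA S (- S) (b + beta * T)),
      (RInt_zero_on A (- S) (b + beta * T)).
    + rewrite <- (opp_RInt_swap A (- S) S) by solve_continuous.
      simpl; unfold plus, opp, zero; simpl; ring.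
    + intros s Hs; apply HAout; rewrite Rmin_right, Rmax_left in Hs by (unfold K, S in *; lra).
      rewrite Rabs_left; unfold K, S in *; lra.
  - assert (Hpos' : 0 < beta)
      by (apply Rnot_lt_le in Hpos; destruct Hpos as [|E]; [auto|symmetry in E; contradiction]).
    rewrite Rabs_pos_eq in HK by lra.
    rewrite <- (RInt_Chasles_continuous A HA b S (b + beta * T)),
      (RInt_zero_on A S (b + beta * T)); [real_eq; ring|].
    intros s Hs; apply HAout; rewrite Rmin_left, Rmax_right in Hs by (unfold K, S in *; lra).
    rewrite Rabs_pos_eq; unfold K, S in *; lra.
Qed.

Lemma RInt_Xray_along_lines T X : Rabs (fst g) <= 1 -> beta <> 0 -> 0 <= T ->
  K / Rabs beta <= T -> R0 + T <= X ->
  RInt (fun x => Xray g H (x, b + lam * x)) (- X) X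
  = (RInt A b S - (if Rlt_dec beta 0 then RInt A (- S) S else 0)) / beta.
Proof.
  intros Hg1 Hbeta HT HKT HX.
  rewrite (RInt_ext _ (fun x => RInt (fun t => H (x + t * fst g, b + lam * x + t * snd g)) 0 T)).
  2:{ intros x _; rewrite (Xray_truncate g H _ T) by
        (auto; intros t Ht; apply ray_outside_box; auto; lra); reflexivity. }
  rewrite (RInt_Fubini (fun x t => H (x + t * fst g, b + lam * x + t * snd g))) by solve_continuous.
  rewrite (RInt_ext _ (fun t => A (b + t * beta))).
  2:{ intros t Ht; rewrite Rmin_left, Rmax_right in Ht by lra.
      apply RInt_ray_shift; auto; rewrite Rabs_pos_eq; lra. }
  rewrite RInt_line_integral_ray, RInt_line_integral_tail; auto.
  assert (Hb : 0 < Rabs beta) by (apply Rabs_pos_lt; auto).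
  apply (Rmult_le_compat_l (Rabs beta)) in HKT; [|lra].
  unfold Rdiv in HKT; rewrite <- Rmult_assoc, (Rmult_comm (Rabs beta)), Rmult_assoc, Rinv_r,
    Rmult_1_r in HKT; lra.
Qed.

End BeamAlongLines.

(** * Good directions *)

(* Scale-invariant form of [psi] lying off [Z_1] with [gamma(psi) <> 0]. *)
Definition good_direction (m : nat) (gam : nat -> pt) (c : nat -> R) (w : pt) : Prop :=
  (forall i, (i < m)%nat -> dot w (gam i) <> 0) /\
  vsum m (fun i => vscal (c i / dot w (gam i)) (gam i)) <> (0, 0).

Lemma good_direction_of_gamma_psi m gam c psi :
  not_in_Z1 m gam psi -> gamma_psi m gam c psi <> (0, 0) -> good_direction m gam c psi.
Proof.
  intros [_ Hz] Hpsi; split; auto; intros E; apply Hpsi; unfold gamma_psi; rewrite E.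
  unfold vscal; simpl; f_equal; ring.
Qed.

Lemma good_direction_scale m gam c w s : s <> 0 ->
  good_direction m gam c w -> good_direction m gam c (vscal s w).
Proof.
  intros Hs [Hdot Hsum].
  assert (Hd : forall i, dot (vscal s w) (gam i) = s * dot w (gam i))
    by (intros i; unfold dot, vscal; simpl; ring).
  split; [intros i Hi; rewrite Hd; apply Rmult_integral_contrapositive; auto|].
  intros E; apply Hsum, injective_projections; simpl;
    [apply (f_equal fst) in E; rewrite !vsum_fst in *
    |apply (f_equal snd) in E; rewrite !vsum_snd in *];
    simpl in *; apply (Rmult_eq_reg_l (/ s)); try (apply Rinv_neq_0_compat; auto);
    rewrite Rmult_0_r, <- E, <- rsum_scal; apply rsum_ext; intros i Hi; rewrite Hd;
    field; auto.
Qed.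

Lemma locally_forall_lt (P : nat -> R -> Prop) x m :
  (forall k, (k < m)%nat -> locally x (P k)) -> locally x (fun t => forall k, (k < m)%nat -> P k t).
Proof.
  induction m as [|m IH]; intros HP; [apply filter_forall; intros; lia|].
  apply (filter_imp (fun t => (forall k, (k < m)%nat -> P k t) /\ P m t)).
  - intros t [Hlt Hm] k Hk; destruct (Nat.eq_dec k m) as [->|]; auto; apply Hlt; lia.
  - apply filter_and; [apply IH; auto|apply HP; lia].
Qed.

Lemma continuous_div_comp (f g : R -> R) x :
  continuous f x -> continuous g x -> g x <> 0 -> continuous (fun t => f t / g t) x.
Proof.
  intros Hf Hg Hgx; apply (continuous_mult f (fun t => / g t)); auto.
  apply continuous_Rinv_comp; auto.
Qed.

Lemma good_direction_open m gam c w0 v : good_direction m gam c w0 ->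
  locally 0 (fun t => good_direction m gam c (vadd w0 (vscal t v))).
Proof.
  intros [Hdot Hsum].
  set (d := fun i t => dot (vadd w0 (vscal t v)) (gam i)).
  assert (Hd : forall i, continuous_everywhere (d i))
    by (intros i; unfold d, dot, vadd, vscal; solve_continuous).
  assert (Hd0 : forall i, d i 0 = dot w0 (gam i))
    by (intros i; unfold d, dot, vadd, vscal; simpl; ring).
  assert (Hcomp : forall u : nat -> R,
    continuous (fun t => rsum m (fun i => c i / d i t * u i)) 0).
  { intros u; apply continuous_rsum; intros i Hi.
    apply (continuous_mult (fun t => c i / d i t) (fun _ => u i)); [|apply continuous_const].
    apply continuous_div_comp; [apply continuous_const|apply Hd|rewrite Hd0; auto]. }
  assert (Hsum0 : rsum m (fun i => c i / d i 0 * fst (gam i)) <> 0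
               \/ rsum m (fun i => c i / d i 0 * snd (gam i)) <> 0).
  { destruct (Req_dec (rsum m (fun i => c i / d i 0 * fst (gam i))) 0) as [E1|]; auto.
    destruct (Req_dec (rsum m (fun i => c i / d i 0 * snd (gam i))) 0) as [E2|]; auto.
    exfalso; apply Hsum, injective_projections; rewrite ?vsum_fst, ?vsum_snd; simpl;
      [rewrite <- E1|rewrite <- E2]; apply rsum_ext; intros i _; rewrite Hd0; reflexivity. }
  apply (filter_imp (fun t => (forall i, (i < m)%nat -> d i t <> 0) /\
    (rsum m (fun i => c i / d i t * fst (gam i)) <> 0
     \/ rsum m (fun i => c i / d i t * snd (gam i)) <> 0))).
  - intros t [Hdt Hst]; split; auto.
    intros E; destruct Hst as [Hst|Hst]; apply Hst;
      [apply (f_equal fst) in E; rewrite vsum_fst in E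
      |apply (f_equal snd) in E; rewrite vsum_snd in E]; exact E.
  - apply filter_and.
    + apply locally_forall_lt; intros i Hi; apply continuous_nonzero_locally; [apply Hd|].
      rewrite Hd0; auto.
    + destruct Hsum0 as [H0|H0];
        [eapply filter_imp; [intros t Ht; left; exact Ht|]
        |eapply filter_imp; [intros t Ht; right; exact Ht|]];
        apply continuous_nonzero_locally; auto.
Qed.

Lemma good_direction_slopes m gam c psi : good_direction m gam c psi ->
  exists lam0 d, 0 < d /\ forall lam, lam0 < lam < lam0 + d -> good_direction m gam c (- lam, 1).
Proof.
  intros Hpsi.
  assert (Hpsi' : exists p, good_direction m gam c p /\ snd p <> 0).
  { destruct (Req_dec (snd psi) 0) as [E|E]; [|exists psi; auto].
    destruct (good_direction_open m gam c psi (0, 1) Hpsi) as [eps Heps].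
    pose proof (cond_pos eps).
    exists (vadd psi (vscal (eps / 2) (0, 1))); split.
    - apply Heps; change (Rabs (eps / 2 - 0) < eps); rewrite Rabs_pos_eq; lra.
    - simpl; rewrite E; lra. }
  destruct Hpsi' as [[p1 p2] [Hp Hp2]]; simpl in Hp2.
  destruct (good_direction_open m gam c (p1, p2) (1, 0) Hp) as [eps Heps].
  assert (Hp2abs : 0 < Rabs p2) by (apply Rabs_pos_lt; auto).
  exists (- p1 / p2), (eps / Rabs p2); split; [apply Rdiv_lt_0_compat; auto; apply cond_pos|].
  intros lam Hlam.
  assert (Ht : Rabs (- p2 * lam - p1) < eps).
  { replace (- p2 * lam - p1) with (- p2 * (lam - - p1 / p2)) by (field; auto).
    rewrite Rabs_mult, Rabs_Ropp.
    assert (Hdist : Rabs (lam - - p1 / p2) < eps / Rabs p2) by (rewrite Rabs_pos_eq; lra).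
    apply (Rmult_lt_compat_l (Rabs p2)) in Hdist; auto.
    replace (Rabs p2 * (eps / Rabs p2)) with (pos eps) in Hdist by (field; lra); auto. }
  replace (- lam, 1) with (vscal (/ p2) (vadd (p1, p2) (vscal (- p2 * lam - p1) (1, 0))))
    by (unfold vadd, vscal; simpl; f_equal; field; auto).
  apply good_direction_scale; [apply Rinv_neq_0_compat; auto|].
  apply Heps; change (Rabs (- p2 * lam - p1 - 0) < eps); rewrite Rminus_0_r; auto.
Qed.

Lemma scaled_rotation_injective p q x y : 0 < p * p + q * q ->
  x * p + y * q = 0 -> y * p - x * q = 0 -> x = 0 /\ y = 0.
Proof.
  intros Hpq E1 E2.
  assert (Ex : x * (p * p + q * q) = 0)
    by (replace (x * (p * p + q * q)) with (p * (x * p + y * q) - q * (y * p - x * q)) by ring;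
        rewrite E1, E2; ring).
  assert (Ey : y * (p * p + q * q) = 0)
    by (replace (y * (p * p + q * q)) with (q * (x * p + y * q) + p * (y * p - x * q)) by ring;
        rewrite E1, E2; ring).
  apply Rmult_integral in Ex; apply Rmult_integral in Ey; lra.
Qed.

Section StarKernel.
Variables (m : nat) (gam : nat -> pt) (c : nat -> R) (R0 : R) (h : vfield).
Hypotheses (HR : 0 < R0) (Hunit : forall i, (i < m)%nat -> is_unit (gam i))
  (Hh : continuous_field_in_box R0 h) (Hstar : forall x, star m gam c h x = (0, 0)).

Let S lam := R0 + Rabs lam * R0.
Let tail F lam b := RInt (line_integral R0 F lam) b (S lam).

Let continuous_h1 : continuous_everywhere (fst h).
Proof. apply Hh. Qed.
Let continuous_h2 : continuous_everywhere (snd h).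
Proof. apply Hh. Qed.
Let supported_h1 : supported_in_box R0 (fst h).
Proof. apply Hh. Qed.
Let supported_h2 : supported_in_box R0 (snd h).
Proof. apply Hh. Qed.

Lemma tail_fdot v lam b :
  tail (fdot h v) lam b = fst v * tail (fst h) lam b + snd v * tail (snd h) lam b.
Proof.
  pose proof (continuous_line_integral R0 (fst h) lam continuous_h1).
  pose proof (continuous_line_integral R0 (snd h) lam continuous_h2).
  unfold tail; rewrite (RInt_ext _ (fun s => fst v * line_integral R0 (fst h) lam s
                                              + snd v * line_integral R0 (snd h) lam s)).
  - rewrite RInt_plus_continuous, !RInt_scal_continuous by solve_continuous; reflexivity.
  - intros s _; unfold line_integral, fdot.
    rewrite (RInt_ext _ (fun x => fst v * fst h (x, s + lam * x) + snd v * snd h (x, s + lam * x)))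
      by (intros; real_eq; ring).
    rewrite RInt_plus_continuous, !RInt_scal_continuous by solve_continuous; reflexivity.
Qed.

(* The term of [RInt_Xray_along_lines] that does not depend on [b]. *)
Let correction (F : pt -> R) lam (g : pt) :=
  if Rlt_dec (dot (- lam, 1) g) 0 then RInt (line_integral R0 F lam) (- S lam) (S lam) else 0.

Lemma weighted_beam_integrals (V : nat -> pt) lam : good_direction m gam c (- lam, 1) ->
  (forall x, rsum m (fun i => c i * Xray (gam i) (fdot h (V i)) x) = 0) ->
  forall b, rsum m (fun i => c i * ((tail (fdot h (V i)) lam b
                                     - correction (fdot h (V i)) lam (gam i))
                                    / dot (- lam, 1) (gam i))) = 0.
Proof.
  intros [Hbeta _] Hzero b.
  destruct (exists_upper_bound (fun i => (R0 + Rabs b + Rabs lam * R0)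
                                         / Rabs (dot (- lam, 1) (gam i))) m) as [M HM].
  set (T := Rmax 0 M).
  assert (HT : 0 <= T) by apply Rmax_l.
  assert (HMT : M <= T) by apply Rmax_r.
  rewrite <- (RInt_zero_on _ (- (R0 + T)) (R0 + T) (fun x _ => Hzero (x, b + lam * x))).
  assert (HX : forall i, (i < m)%nat ->
    continuous_everywhere (fun x => Xray (gam i) (fdot h (V i)) (x, b + lam * x))).
  { intros i Hi; apply (continuous_Xray_along_line _ R0); auto;
      [apply continuous_fdot with R0|apply supported_fdot]; auto. }
  rewrite RInt_rsum by (intros i Hi; pose proof (HX i Hi); solve_continuous).
  apply rsum_ext; intros i Hi.
  assert (Hg1 : Rabs (fst (gam i)) <= 1)
    by (apply Rabs_le; specialize (Hunit i Hi); unfold is_unit, dot in Hunit; nra).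
  pose proof (Rle_trans _ _ _ (HM i Hi) HMT).
  rewrite RInt_scal_continuous, (RInt_Xray_along_lines _ R0 _ _ _ HR
    (continuous_fdot R0 h (V i) Hh) (supported_fdot R0 h (V i) Hh) T);
    auto using Rle_refl.
Qed.

(* The correction cancels against the value at [b = S lam], where the tail vanishes. *)
Lemma weighted_tails_zero (V : nat -> pt) lam : good_direction m gam c (- lam, 1) ->
  (forall x, rsum m (fun i => c i * Xray (gam i) (fdot h (V i)) x) = 0) ->
  forall b, rsum m (fun i => c i / dot (- lam, 1) (gam i) * tail (fdot h (V i)) lam b) = 0.
Proof.
  intros Hgood Hzero b.
  rewrite <- (Rminus_0_r 0), <- (weighted_beam_integrals V lam Hgood Hzero b) at 1.
  rewrite <- (weighted_beam_integrals V lam Hgood Hzero (S lam)), <- rsum_minus.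
  apply rsum_ext; intros i Hi; unfold tail; rewrite RInt_point; unfold zero, Rdiv; simpl.
  real_eq; ring.
Qed.

Lemma line_integrals_zero lam : good_direction m gam c (- lam, 1) ->
  forall s, line_integral R0 (fst h) lam s = 0 /\ line_integral R0 (snd h) lam s = 0.
Proof.
  intros Hgood.
  set (w := fun i => c i / dot (- lam, 1) (gam i)).
  set (p := rsum m (fun i => w i * fst (gam i))).
  set (q := rsum m (fun i => w i * snd (gam i))).
  assert (Hpq : 0 < p * p + q * q).
  { destruct Hgood as [_ Hsum].
    destruct (Req_dec p 0) as [Hp|Hp]; [destruct (Req_dec q 0) as [Hq|Hq]|].
    - exfalso; apply Hsum, injective_projections; rewrite ?vsum_fst, ?vsum_snd; auto.
    - pose proof (Rsqr_pos_lt q Hq); pose proof (Rle_0_sqr p); unfold Rsqr in *; lra.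
    - pose proof (Rsqr_pos_lt p Hp); pose proof (Rle_0_sqr q); unfold Rsqr in *; lra. }
  assert (Hcombine : forall V : nat -> pt,
    (forall x, rsum m (fun i => c i * Xray (gam i) (fdot h (V i)) x) = 0) ->
    forall b, tail (fst h) lam b * rsum m (fun i => w i * fst (V i))
              + tail (snd h) lam b * rsum m (fun i => w i * snd (V i)) = 0).
  { intros V HV b; rewrite <- (weighted_tails_zero V lam Hgood HV b), <- !rsum_scal, <- rsum_plus.
    apply rsum_ext; intros i _; rewrite tail_fdot; unfold w; real_eq; ring. }
  assert (Htails : forall b, tail (fst h) lam b = 0 /\ tail (snd h) lam b = 0).
  { intros b.
    assert (Hfst : forall x, rsum m (fun i => c i * Xray (gam i) (fdot h (gam i)) x) = 0)
      by (intros x; rewrite <- star_fst, Hstar; reflexivity).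
    assert (Hsnd : forall x,
      rsum m (fun i => c i * Xray (gam i) (fdot h (perp (gam i))) x) = 0)
      by (intros x; rewrite <- star_snd, Hstar; reflexivity).
    pose proof (Hcombine gam Hfst b) as E1.
    pose proof (Hcombine (fun i => perp (gam i)) Hsnd b) as E2.
    simpl in E2; fold p q in E1.
    rewrite (rsum_ext _ _ (fun i => -1 * (w i * snd (gam i)))), rsum_scal in E2 by (intros; ring).
    fold p q in E2.
    apply scaled_rotation_injective with p q; auto; lra. }
  intros s; split; apply (RInt_tails_zero _ (S lam)).
  - apply continuous_line_integral, continuous_h1.
  - intros b; exact (proj1 (Htails b)).
  - apply continuous_line_integral, continuous_h2.
  - intros b; exact (proj2 (Htails b)).
Qed.

Theorem star_kernel_trivial psi : not_in_Z1 m gam psi -> gamma_psi m gam c psi <> (0, 0) ->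
  forall y, fst h y = 0 /\ snd h y = 0.
Proof.
  intros Hpsi Hgam.
  destruct (good_direction_slopes m gam c psi (good_direction_of_gamma_psi m gam c psi Hpsi Hgam))
    as [lam0 [d [Hd Hslopes]]].
  intros y; split.
  - apply (zero_of_line_integrals_slope_interval _ R0 lam0 d HR Hd continuous_h1 supported_h1).
    intros lam Hlam s; exact (proj1 (line_integrals_zero lam (Hslopes lam Hlam) s)).
  - apply (zero_of_line_integrals_slope_interval _ R0 lam0 d HR Hd continuous_h2 supported_h2).
    intros lam Hlam s; exact (proj2 (line_integrals_zero lam (Hslopes lam Hlam) s)).
Qed.

End StarKernel.

Lemma Rabs_fst_le_vnorm y : Rabs (fst y) <= vnorm y.
Proof. unfold vnorm, dot; rewrite <- sqrt_Rsqr_abs; apply sqrt_le_1_alt; unfold Rsqr; nra. Qed.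

Lemma Rabs_snd_le_vnorm y : Rabs (snd y) <= vnorm y.
Proof. unfold vnorm, dot; rewrite <- sqrt_Rsqr_abs; apply sqrt_le_1_alt; unfold Rsqr; nra. Qed.

Lemma C2c_disc_in_box r F : C2c_disc r F -> continuous_everywhere F /\ supported_in_box r F.
Proof.
  intros [[[_ [_ [HF _]]] _] [r' [Hr' Hsupp]]]; split; [exact HF|].
  intros y Hy; apply Hsupp.
  pose proof (Rabs_fst_le_vnorm y); pose proof (Rabs_snd_le_vnorm y); destruct Hy; lra.
Qed.

Theorem corollary2 (r : R) (m : nat) (gam : nat -> pt) (c : nat -> R) :
  0 < r ->
  (forall i, (i < m)%nat -> is_unit (gam i)) ->
  (forall i j, (i < m)%nat -> (j < m)%nat -> i <> j -> gam i <> gam j) ->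
  (forall i, (i < m)%nat -> c i <> 0) ->
  (exists psi, not_in_Z1 m gam psi /\ gamma_psi m gam c psi <> (0, 0)) ->
  forall f g : vfield,
    C2c_disc r (fst f) -> C2c_disc r (snd f) ->
    C2c_disc r (fst g) -> C2c_disc r (snd g) ->
    (forall x, star m gam c f x = star m gam c g x) ->
    f = g.
Proof.
  intros Hr Hunit _ _ [psi [Hpsi Hgam]] f g Hf1 Hf2 Hg1 Hg2 Hstar.
  assert (Hf : continuous_field_in_box r f)
    by (destruct (C2c_disc_in_box r _ Hf1), (C2c_disc_in_box r _ Hf2); repeat split; auto).
  assert (Hg : continuous_field_in_box r g)
    by (destruct (C2c_disc_in_box r _ Hg1), (C2c_disc_in_box r _ Hg2); repeat split; auto).
  assert (Hker : forall x, star m gam c (vfield_sub f g) x = (0, 0)).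
  { intros x; rewrite (star_sub m gam c r f g x Hunit Hf Hg), Hstar.
    unfold vadd, vscal; f_equal; simpl; ring. }
  pose proof (star_kernel_trivial m gam c r (vfield_sub f g) Hr Hunit
    (continuous_field_in_box_sub r f g Hf Hg) Hker psi Hpsi Hgam) as Hzero.
  destruct f as [f1 f2], g as [g1 g2]; simpl in Hzero.
  f_equal; apply functional_extensionality; intros y; destruct (Hzero y); lra.
Qed.
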